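(* Let $\Omega=\{\omega_1,\dots,\omega_n\}$ be a finite set of states and let $\mathcal{D}=\{(p^i,x^i)\}_{i=1}^k$ be a finite dataset of prices and asset demands, with $p^i,x^i\in\mathbb{R}^n_+$ and $p^i\gg\mathbf{0}$ for all $i\le k$. If $\mathcal{D}$ is SEU-rationalizable by a strictly concave and strictly increasing utility function under a full-support probability measure $\pi$ on $\Omega$, and each $x^i$ is a non-diversified demand, then $\mathcal{D}$ is also SEU-rationalizable under $\pi$ by a: (i) $u_1^{\alpha}$, for any $\alpha\in(0,1)$, such that for some $c_\alpha>0$, $u_1^{\alpha}(x):=(x+c_\alpha)^\alpha$ (DARA-risk-averse with positive fixed initial wealth); (ii) $u_2$ such that, for some $\beta>0$, $u_2(x):=1-e^{-\beta x}$ (CARA-risk-averse); (iii) $u_3$ such that, for some $\lambda>0$, $u_3(x):=x-\lambda x^2$ (IARA-risk-averse/increasing in a neighborhood of $0$); (iv) $u_4$ such that, for some $\gamma>0$, $u_4(x):=\dfrac{x}{1+\gamma x}$ (IARA-risk-averse/increasing in $\mathbb{R}_+$); (v) linear $u$; (vi) strictly convex $v$.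
   Context: Vectors in $\mathbb{R}^n$ are indexed by states $\omega\in\Omega$; $p^i$ is a price vector and $x^i$ the demand at those prices. $x\gg y$ means $x_\omega>y_\omega$ for all $\omega\in\Omega$. A probability measure $\pi$ on $\Omega$ has full support if $\pi(\omega)>0$ for all $\omega\in\Omega$. Non-diversified demand: $x^i$ is a non-diversified demand if there exists $\omega\in\Omega$ for which $x^i_\omega>0$ and $x^i_{\omega'}=0$ for all $\omega'\neq\omega$. SEU-rationalizability: $\mathcal{D}$ is rationalizable by subjective expected utility (SEU-rationalizable) if there is a probability measure $\pi$ over $\Omega$ and an increasing function $u:\mathbb{R}\to\mathbb{R}$ such that, for all $i\le k$, $$\mathbb{E}_\pi u(x^i_\omega)\ \ge\ \mathbb{E}_\pi u(x_\omega)\quad\text{for all }x\in\mathbb{R}^n_+\text{ that satisfies }p^i\cdot x\le p^i\cdot x^i,$$ where $\mathbb{E}_\pi u(x_\omega)=\sum_{\omega\in\Omega}\pi(\omega)u(x_\omega)$. $\mathcal{D}$ is SEU-rationalizable by $u$ under $\pi$ when this holds for that particular $u$ and $\pi$. DARA, CARA and IARA stand for decreasing, constant and increasing absolute risk aversion, respectively, absolute risk aversion of a utility function $u$ at $x$ being $-u''(x)/u'(x)$.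
   Formalization: In (iv) the label ''IARA'' is dropped because it is false: for x/(1+γx) the absolute risk aversion is 2γ/(1+γx), strictly decreasing on R_+ for every γ>0; (iv) states rationalizability, strict concavity and strict increase on R_+. *)

(* Defs.v *)
From HB Require Import structures.
From mathcomp Require Import all_boot all_order all_algebra.
From mathcomp Require Import all_classical all_reals all_analysis.
Set Implicit Arguments.
Unset Strict Implicit.
Unset Printing Implicit Defensive.
Import Order.TTheory GRing.Theory Num.Theory.
Import numFieldNormedType.Exports.
Local Open Scope classical_set_scope.
Local Open Scope ring_scope.

(* A vector of R^n, n = #|Omega|, is a function {ffun Omega -> R}. *)

Definition nonneg_vec (R : realType) (Omega : finType)
    (y : {ffun Omega -> R}) : Prop :=
  forall w, 0 <= y w.

Definition positive_vec (R : realType) (Omega : finType)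
    (y : {ffun Omega -> R}) : Prop :=
  forall w, 0 < y w.

Definition dot (R : realType) (Omega : finType)
    (p y : {ffun Omega -> R}) : R :=
  \sum_(w : Omega) p w * y w.

Definition probability_measure (R : realType) (Omega : finType)
    (pi : {ffun Omega -> R}) : Prop :=
  (forall w, 0 <= pi w) /\ \sum_(w : Omega) pi w = 1.

Definition full_support (R : realType) (Omega : finType)
    (pi : {ffun Omega -> R}) : Prop :=
  forall w, 0 < pi w.

Definition expected_utility (R : realType) (Omega : finType)
    (pi : {ffun Omega -> R}) (u : R -> R) (y : {ffun Omega -> R}) : R :=
  \sum_(w : Omega) pi w * u (y w).

Definition non_diversified (R : realType) (Omega : finType)
    (y : {ffun Omega -> R}) : Prop :=
  exists w, 0 < y w /\ forall w', w' != w -> y w' = 0.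

(* Only the values of u on [0, +oo[ matter here. Monotonicity of u is not
   part of this predicate: it is stated next to it, on the domain where
   it is meant to hold. *)
Definition SEU_rationalizes (R : realType) (Omega : finType) (k : nat)
    (p x : 'I_k -> {ffun Omega -> R}) (pi : {ffun Omega -> R})
    (u : R -> R) : Prop :=
  forall (i : 'I_k) (y : {ffun Omega -> R}),
    nonneg_vec y -> dot (p i) y <= dot (p i) (x i) ->
    expected_utility pi u y <= expected_utility pi u (x i).

Definition strictly_increasing_on (R : realType) (D : set R) (u : R -> R)
    : Prop :=
  {in D &, {homo u : a b / a < b}}.

Definition strictly_concave_on (R : realType) (D : set R) (u : R -> R)
    : Prop :=
  forall a b t : R, D a -> D b -> a != b -> 0 < t -> t < 1 ->
    t * u a + (1 - t) * u b < u (t * a + (1 - t) * b).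

Definition strictly_convex_on (R : realType) (D : set R) (u : R -> R)
    : Prop :=
  forall a b t : R, D a -> D b -> a != b -> 0 < t -> t < 1 ->
    u (t * a + (1 - t) * b) < t * u a + (1 - t) * u b.

Definition absolute_risk_aversion (R : realType) (u : R -> R) (a : R) : R :=
  - (u^`(2)%classic a) / (u^`()%classic a).

(* Derivatives and division are total functions, so the three notions below
   require absolute risk aversion to be well defined. *)
Definition has_absolute_risk_aversion_on (R : realType) (D : set R)
    (u : R -> R) : Prop :=
  forall a, D a ->
    [/\ derivable u a 1, derivable (u^`()%classic) a 1 & u^`()%classic a != 0].

Definition DARA_on (R : realType) (D : set R) (u : R -> R) : Prop :=
  has_absolute_risk_aversion_on D u /\
  {in D &, forall a b, a < b ->
    absolute_risk_aversion u b < absolute_risk_aversion u a}.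

Definition CARA_on (R : realType) (D : set R) (u : R -> R) : Prop :=
  has_absolute_risk_aversion_on D u /\
  {in D &, forall a b,
    absolute_risk_aversion u a = absolute_risk_aversion u b}.

Definition IARA_on (R : realType) (D : set R) (u : R -> R) : Prop :=
  has_absolute_risk_aversion_on D u /\
  {in D &, forall a b, a < b ->
    absolute_risk_aversion u a < absolute_risk_aversion u b}.

(* Main.v *)
(** If a strictly concave utility makes the whole budget go to state w, then
    the price-probability ratio p_w / pi_w is strictly the smallest one, and by
    finiteness pi_w' p_w <= r pi_w p_w' for one r < 1 over all observations.
    Conversely, under these inequalities any nondecreasing utility whose slopes
    on the relevant interval [0, L] all lie in [m, m / r] for some m rationalizes
    the data, concave or not. Each of the six families contains members that
    are nearly linear on [0, L] in this sense. *)

Require Import Defs.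
From HB Require Import structures.
From mathcomp Require Import all_boot all_order all_algebra.
From mathcomp Require Import all_classical all_reals all_analysis.
From mathcomp Require Import ring lra.
Set Implicit Arguments.
Unset Strict Implicit.
Unset Printing Implicit Defensive.
Import Order.TTheory GRing.Theory Num.Theory.
Import numFieldNormedType.Exports.
Local Open Scope classical_set_scope.
Local Open Scope ring_scope.

(** * Derivative criteria for monotonicity and convexity, and absolute risk aversion *)

Lemma MVT_interval (R : realType) (D : set R) (u du : R -> R) :
  is_interval D -> (forall z, D z -> is_derive z 1 u (du z)) ->
  forall a b, D a -> D b -> a < b ->
    exists c, [/\ a < c, c < b, D c & u b - u a = du c * (b - a)].
Proof.
move=> itvD duD a b Da Db ab.
have subD z : a <= z <= b -> D z by exact: itvD.
have [z zab|z|c cab ->] := @MVT R u du a b ab.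
- by apply/duD/subD; move: zab; rewrite in_itv/= => /andP[/ltW-> /ltW->].
- apply: derivable_within_continuous => {}z zab.
  by have [] := duD z (subD z zab).
by exists c; move: cab; rewrite in_itv/= => /andP[ac cb]; split=> //;
  apply: subD; rewrite !ltW.
Qed.

Lemma gt0_derive_strictly_increasing (R : realType) (D : set R) (u du : R -> R) :
  is_interval D -> (forall z, D z -> is_derive z 1 u (du z)) ->
  (forall z, D z -> 0 < du z) -> strictly_increasing_on D u.
Proof.
move=> itvD duD du0 a b; rewrite !inE => Da Db ab.
have [c [_ _ Dc uE]] := MVT_interval itvD duD Da Db ab.
by rewrite -subr_gt0 uE mulr_gt0 ?du0 ?subr_gt0.
Qed.

(** The mean value theorem on each side of the convex combination [z] yields slopes [du c1] and
    [du c2] with [c1 < z < c2], hence [du c1 < du c2]. *)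
Lemma increasing_derive_strictly_convex (R : realType) (D : set R)
    (u du : R -> R) :
  is_interval D -> (forall z, D z -> is_derive z 1 u (du z)) ->
  (forall a b, D a -> D b -> a < b -> du a < du b) -> strictly_convex_on D u.
Proof.
move=> itvD duD du_incr a b t + + + t0 t1.
(* Swapping [a] with [b] and [t] with [1 - t] leaves the convex combination unchanged. *)
wlog ab : a b t t0 t1 / a < b => [hw Da Db aDb|Da Db _].
  have [ab|ba|E] := ltgtP a b; [exact: hw| |by rewrite E eqxx in aDb].
  have t0' : 0 < 1 - t by lra.
  have t1' : 1 - t < 1 by lra.
  have := hw b a (1 - t) t0' t1' ba Db Da.
  rewrite subKr eq_sym => /(_ aDb).
  by rewrite [in X in u X](addrC _ (t * a)) [ltRHS]addrC.
set z := t * a + (1 - t) * b.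
have zaE : z - a = (1 - t) * (b - a) by rewrite /z; ring.
have bzE : b - z = t * (b - a) by rewrite /z; ring.
have ba0 : 0 < b - a by rewrite subr_gt0.
have az : a < z by rewrite -subr_gt0 zaE mulr_gt0 // subr_gt0.
have zb : z < b by rewrite -subr_gt0 bzE mulr_gt0.
have Dz : D z by apply: (itvD a b) => //; rewrite !ltW.
have [c1 [_ c1z Dc1 E1]] := MVT_interval itvD duD Da Dz az.
have [c2 [zc2 _ Dc2 E2]] := MVT_interval itvD duD Dz Db zb.
have c12 := du_incr _ _ Dc1 Dc2 (lt_trans c1z zc2).
have : 0 < t * (1 - t) * (b - a) * (du c2 - du c1).
  by rewrite !mulr_gt0 // subr_gt0.
(* The right-hand side is the convexity gap [t * u a + (1 - t) * u b - u z], rearranged. *)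
have -> : t * (1 - t) * (b - a) * (du c2 - du c1)
        = (1 - t) * (u b - u z) - t * (u z - u a).
  by rewrite E1 E2 zaE bzE; ring.
lra.
Qed.

Lemma decreasing_derive_strictly_concave (R : realType) (D : set R)
    (u du : R -> R) :
  is_interval D -> (forall z, D z -> is_derive z 1 u (du z)) ->
  (forall a b, D a -> D b -> a < b -> du b < du a) -> strictly_concave_on D u.
Proof.
move=> itvD duD du_decr a b t Da Db ab t0 t1.
have duND z : D z -> is_derive z 1 (- u) (- du z).
  by move=> Dz; apply: is_deriveN; exact: duD.
have duN a' b' : D a' -> D b' -> a' < b' -> - du a' < - du b'.
  by move=> Da' Db' ab'; rewrite ltrN2; exact: du_decr.
have := increasing_derive_strictly_convex itvD duND duN Da Db ab t0 t1.
by rewrite /= !fctE; lra.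
Qed.

(** Differentiating [u] twice at [a] requires its derivative to equal [du] on a whole neighborhood
    of [a], hence the first hypothesis. *)
Lemma absolute_risk_aversionE (R : realType) (u du : R -> R) (a ddu : R) :
  (\forall z \near a, is_derive (z : R) 1 u (du z)) -> is_derive a 1 du ddu ->
  du a != 0 ->
  [/\ derivable u a 1, derivable (u^`()%classic) a 1 & u^`()%classic a != 0]
  /\ absolute_risk_aversion u a = - ddu / du a.
Proof.
move=> du_near ddua dua0.
have u'E (z : R) : is_derive z 1 u (du z) -> u^`()%classic z = du z.
  by move=> duz; rewrite derive1E derive_val.
have dua := nbhs_singleton du_near.
have ddua' : is_derive a 1 (u^`()%classic) ddu.
  apply: near_eq_is_derive ddua; near=> z; apply/esym/u'E.
  by near: z.
split; first by split; [case: dua|case: ddua'|rewrite u'E].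
rewrite /absolute_risk_aversion u'E //; congr (- _ / _).
by rewrite derive1nS derive1n1 derive1E derive_val.
Unshelve. all: by end_near. Qed.

(** * Price-probability ratios and slope bounds *)

Section Rationalization.
Context (R : realType) (Omega : finType) (k : nat).
Context (p x : 'I_k -> {ffun Omega -> R}) (pi : {ffun Omega -> R}).
Context (p_pos : forall i, positive_vec (p i)) (pi_full : full_support pi).
Context (x_nondiv : forall i, non_diversified (x i)).

Lemma non_diversified_eq0 i w v : 0 < x i w -> v != w -> x i v = 0.
Proof.
have [w0 [_ x0]] := x_nondiv i => xw0 vw; apply: (x0).
suff <- : w = w0 by [].
by apply/eqP; apply: contraTT xw0 => /x0 ->; rewrite ltxx.
Qed.

Lemma dot_non_diversified i w : 0 < x i w -> dot (p i) (x i) = p i w * x i w.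
Proof.
move=> xw0; rewrite /dot (bigD1 w) //= big1 ?addr0 // => v vw.
by rewrite (non_diversified_eq0 xw0 vw) mulr0.
Qed.

(* With X the demand in state w, the test bundle holding
   t = p_w X / (p_w + p_w') in both w and w' costs exactly p_w X, and t is a
   convex combination of X and 0. *)
Lemma strictly_concave_price_ratio (u : R -> R) i w w' :
  strictly_concave_on setT u -> strictly_increasing_on setT u ->
  SEU_rationalizes p x pi u -> 0 < x i w -> w' != w ->
  pi w' * p i w < pi w * p i w'.
Proof.
move=> u_conc u_incr u_rat xw0 w'w.
have x0 v (vw : v != w) := non_diversified_eq0 xw0 vw.
have pw := p_pos i w; have pw' := p_pos i w'.
set P := p i w in pw *; set Q := p i w' in pw' *; set X := x i w in xw0.
have PQ : 0 < P + Q by rewrite addr_gt0.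
pose th := P / (P + Q).
have th0 : 0 < th by rewrite divr_gt0.
have th1 : th < 1 by rewrite ltr_pdivrMr // mul1r ltrDl.
have thE : th * (P + Q) = P by rewrite divfK ?gt_eqF.
pose t := th * X.
pose y : {ffun Omega -> R} := [ffun v => if (v == w) || (v == w') then t else 0].
have y_nonneg : nonneg_vec y.
  by move=> v; rewrite ffunE; case: ifP => // _; rewrite mulr_ge0 ?ltW.
have y_budget : dot (p i) y <= dot (p i) (x i).
  rewrite (dot_non_diversified xw0) /dot.
  rewrite (bigD1 w) //= (bigD1 w') //= big1 => [|v /andP[vw vw']]; last first.
    by rewrite ffunE (negPf vw) (negPf vw') mulr0.
  rewrite !ffunE !eqxx orbT /= addr0 -/P -/Q -/X -mulrDl /t mulrA.
  by rewrite [(P + Q) * _]mulrC thE.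
have := u_rat i y y_nonneg y_budget.
rewrite /expected_utility (bigD1 w) //= (bigD1 w') //= [leRHS](bigD1 w) //=.
rewrite [X in _ <= _ + X](bigD1 w') //= !ffunE !eqxx orbT /= (x0 w' w'w).
rewrite (eq_bigr (fun v => pi v * u (x i v))) => [|v /andP[vw vw']]; last first.
  by rewrite ffunE (negPf vw) (negPf vw') x0.
(* Outside [w] and [w'] both bundles are 0, so these states cancel and optimality compares
   [(pi w + pi w') * u t] with [pi w * u X + pi w' * u 0]. *)
rewrite !addrA lerD2r -/X => opt.
have X0 : X != 0 by rewrite gt_eqF.
have := u_conc X 0 th Logic.I Logic.I X0 th0 th1.
rewrite mulr0 addr0 -/t => conc.
have uX : u 0 < u X by apply: u_incr; rewrite ?inE.
have piw := pi_full w; have piw' := pi_full w'.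
have : 0 < (pi w * (1 - th) - pi w' * th) * (u X - u 0).
  have : 0 < (pi w + pi w') * (u t - (th * u X + (1 - th) * u 0)).
    by apply: mulr_gt0; [exact: addr_gt0|rewrite subr_gt0].
  lra.
(* Multiplication by [P + Q] turns the weights [th] and [1 - th] back into the prices [P] and
   [Q]. *)
have QE : (1 - th) * (P + Q) = Q by lra.
rewrite pmulr_lgt0; last by rewrite subr_gt0.
rewrite subr_gt0 => lt_pi.
have -> : pi w' * P = pi w' * th * (P + Q) by rewrite -mulrA thE.
have -> : pi w * Q = pi w * (1 - th) * (P + Q) by rewrite -mulrA QE.
by rewrite ltr_pM2r.
Qed.

(** Finitely many strict inequalities leave a uniform margin [r < 1]. The number [L] bounds the
    quantity that any observed budget can buy in a single state. *)
Lemma uniform_bounds :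
  (forall i w w', 0 < x i w -> w' != w -> pi w' * p i w < pi w * p i w') ->
  exists r L : R, [/\ 0 < r, r < 1, 0 < L,
    forall i w w', 0 < x i w -> w' != w -> pi w' * p i w <= r * (pi w * p i w')
  & forall i w, dot (p i) (x i) <= L * p i w].
Proof.
move=> ratio.
pose ok (j : 'I_k * Omega * Omega) := (0 < x j.1.1 j.1.2) && (j.2 != j.1.2).
pose f (j : 'I_k * Omega * Omega) :=
  pi j.2 * p j.1.1 j.1.2 / (pi j.1.2 * p j.1.1 j.2).
pose g (j : 'I_k * Omega) := dot (p j.1) (x j.1) / p j.1 j.2.
have den i w w' : 0 < pi w * p i w' by rewrite mulr_gt0 ?pi_full ?p_pos.
(* The starting values 1/2 and 1 keep [r] inside (0, 1) and [L] positive even when no index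
   qualifies, as with no observation. *)
exists (\big[Num.max/2^-1]_(j | ok j) f j), (\big[Num.max/1]_j g j); split.
- by rewrite (lt_le_trans _ (bigmax_ge_id _ _ _ _)) // invr_gt0 ltr0n.
- apply: bigmax_lt => [|j /andP[j0 j1]]; first by lra.
  by rewrite ltr_pdivrMr // mul1r; exact: ratio.
- by rewrite (lt_le_trans _ (bigmax_ge_id _ _ _ _)).
- move=> i w w' xw w'w; rewrite -ler_pdivrMr //.
  by apply: (@le_bigmax_cond _ _ _ _ (i, w, w') ok f); rewrite /ok xw.
move=> i w; rewrite -ler_pdivrMr ?p_pos //.
exact: (@le_bigmax _ _ _ _ g (i, w)).
Qed.

(* [pi w0 * m / p w0] serves as Lagrange multiplier of the budget constraint,
   w0 being the state carrying the demand. *)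
Lemma SEU_rationalizes_of_derive_bounds (r L m : R) (u du : R -> R) :
  0 <= m ->
  (forall i w w', 0 < x i w -> w' != w ->
    pi w' * p i w <= r * (pi w * p i w')) ->
  (forall i w, dot (p i) (x i) <= L * p i w) ->
  (forall z, z \in `[0, L] -> is_derive z 1 u (du z)) ->
  (forall z, z \in `[0, L] -> m <= du z /\ r * du z <= m) ->
  SEU_rationalizes p x pi u.
Proof.
move=> m0 r_ratio L_budget duD du_bound i y y_ge0 y_budget.
(* Difference quotients of [u] on [[0, L]] inherit both derivative bounds; the upper one is kept
   multiplied by [r]. *)
have slope a b : 0 <= a -> a <= b -> b <= L ->
    m * (b - a) <= u b - u a /\ r * (u b - u a) <= m * (b - a).
  move=> a0; rewrite le_eqVlt => /predU1P[-> _|ab bL].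
    by rewrite !subrr !mulr0.
  have Da : a \in `[0, L] by rewrite in_itv/= a0 (le_trans (ltW ab)).
  have Db : b \in `[0, L] by rewrite in_itv/= bL (le_trans a0 (ltW ab)).
  have [c [_ _ Dc ->]] := MVT_interval (@interval_is_interval _ _) duD Da Db ab.
  have [mc rc] := du_bound c Dc.
  by rewrite mulrA !ler_wpM2r // subr_ge0 ltW.
have [w0 [xw0 _]] := x_nondiv i.
have pw0 := p_pos i w0; have piw0 := pi_full w0.
have y_le w : p i w * y w <= dot (p i) y.
  rewrite /dot (bigD1 w) //= lerDl sumr_ge0 // => v _.
  by rewrite mulr_ge0 // ltW // p_pos.
have yL w : y w <= L.
  rewrite -(ler_pM2l (p_pos i w)) [leRHS]mulrC.
  exact: le_trans (y_le w) (le_trans y_budget (L_budget i w)).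
pose mu := pi w0 * m / p i w0.
have mu0 : 0 <= mu by rewrite divr_ge0 ?mulr_ge0 // ltW.
have muE : mu * p i w0 = pi w0 * m by rewrite divfK ?gt_eqF.
(* In each state the expected utility gain is at most [mu] times the extra cost. In [w0] the
   quantity can only fall, so the lower slope bound applies; elsewhere it rises from 0, so the upper
   bound and the price ratio apply. Summation and the budget constraint then conclude. *)
have key w : pi w * (u (y w) - u (x i w)) <= mu * (p i w * (y w - x i w)).
  have [->|ww0] := eqVneq w w0.
    have yx : y w0 <= x i w0.
      rewrite -(ler_pM2l pw0) -dot_non_diversified //.
      exact: le_trans (y_le w0) y_budget.
    have xL : x i w0 <= L.
      by rewrite -(ler_pM2l pw0) -dot_non_diversified // [leRHS]mulrC.
    have [s _] := slope _ _ (y_ge0 w0) yx xL.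
    rewrite mulrA muE -mulrA; apply: ler_wpM2l; first exact: ltW.
    lra.
  rewrite (non_diversified_eq0 xw0 ww0) subr0.
  have [s1 s2] := slope _ _ (lexx 0) (y_ge0 w) (yL w).
  rewrite subr0 in s1 s2.
  have uy0 : 0 <= u (y w) - u 0 by rewrite (le_trans _ s1) // mulr_ge0.
  have E : mu * (p i w * y w) * p i w0 = pi w0 * p i w * (m * y w).
    by rewrite mulrAC muE; ring.
  rewrite -(ler_pM2r pw0) E.
  have h := ler_wpM2r uy0 (r_ratio i w0 w xw0 ww0).
  have h' := ler_wpM2l (mulr_ge0 (ltW piw0) (ltW (p_pos i w))) s2.
  lra.
rewrite -subr_le0 /expected_utility -sumrB.
apply: (@le_trans _ _ (\sum_w mu * (p i w * (y w - x i w)))).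
  by apply: ler_sum => w _; rewrite -mulrBr.
rewrite -mulr_sumr mulr_ge0_le0 //.
under eq_bigr do rewrite mulrBr.
by rewrite sumrB subr_le0.
Qed.

End Rationalization.

(** * Derivatives of the utility families *)

Lemma is_derive_affine (R : realType) (a b z : R) :
  is_derive z 1 (fun t => a + b * t) b.
Proof.
have d := is_deriveD (is_derive_cst a z 1) (is_deriveZ b (is_derive_id z 1)).
by apply: (is_derive_eq d); rewrite add0r /GRing.scale/= mulr1.
Qed.

Lemma is_derive_expRM (R : realType) (b z : R) :
  is_derive z 1 (fun a => expR (b * a)) (b * expR (b * z)).
Proof.
have d := is_derive_affine 0 b z.
under eq_fun do rewrite -[b * _]add0r.
apply: (is_derive_eq (is_derive1_comp (is_derive_expR _) d)).
by rewrite add0r mulrC.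
Qed.

Lemma is_derive_shift_powR (R : realType) (c alpha z : R) : 0 < z + c ->
  is_derive z 1 (fun a => (a + c) `^ alpha) (alpha * (z + c) `^ (alpha - 1)).
Proof.
move=> zc0.
have d : is_derive z 1 (fun a => a + c) (1 + 0).
  exact: (is_deriveD (is_derive_id z 1) (is_derive_cst c z 1)).
apply: (is_derive_eq (@is_derive1_comp R ((@powR R)^~ alpha) (+%R^~ c) z _ _
  (is_derive1_powR alpha zc0) d)).
by rewrite addr0 mulr1.
Qed.

Lemma is_derive_quadratic (R : realType) (l z : R) :
  is_derive z 1 (fun a => a - l * a ^+ 2) (1 - 2 * l * z).
Proof.
have d := is_deriveB (is_derive_id z 1)
  (is_deriveZ l (is_deriveX 2 (is_derive_id z 1))).
by apply: (is_derive_eq d); rewrite /GRing.scale/=; ring.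
Qed.

Lemma is_derive_homographic (R : realType) (g z : R) : 1 + g * z != 0 ->
  is_derive z 1 (fun a => a / (1 + g * a)) ((1 + g * z) ^- 2).
Proof.
move=> gz0; have dg := is_derive_affine 1 g z.
have dV := @is_deriveV R (fun t => 1 + g * t) z _ _ gz0 dg.
apply: (is_derive_eq (is_deriveM (is_derive_id z 1) dV)).
rewrite /GRing.scale /=; field.
by rewrite gz0.
Qed.

(** * Shape and risk aversion of each family *)

(** Absolute risk aversion is [(1 - alpha) / (a + c)]. Since [c > 0], the point 0 is interior to the
    region [a + c > 0] where the derivative formulas hold. *)
Lemma shift_powR_DARA (R : realType) (c alpha : R) :
  let u := fun a : R => (a + c) `^ alpha in
  0 < c -> 0 < alpha -> alpha < 1 ->
  [/\ strictly_increasing_on `[0, +oo[ u, strictly_concave_on `[0, +oo[ u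
    & DARA_on `[0, +oo[ u].
Proof.
move=> u c0 alpha0 alpha1.
have zc0 z : z \in `[0, +oo[ -> 0 < z + c.
  by rewrite in_itv/= andbT => z0; rewrite ltr_wpDl.
have duD z (Dz : z \in `[0, +oo[) := is_derive_shift_powR alpha (zc0 z Dz).
have itvD := @interval_is_interval R `[0, +oo[.
split.
- apply: gt0_derive_strictly_increasing itvD duD _ => z Dz.
  by rewrite mulr_gt0 // powR_gt0 // zc0.
- apply: decreasing_derive_strictly_concave itvD duD _ => a b Da Db ab.
  (* The exponent [alpha - 1] is negative; passing to inverses reduces the claim to monotonicity of
     a positive power. *)
  rewrite ltr_pM2l // -opprB !powRN ltf_pV2 ?posrE ?powR_gt0 ?zc0 //.
  by rewrite gt0_ltr_powR ?subr_gt0 ?nnegrE ?ltW ?zc0 // ltrD2r.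
have araE a : a \in `[0, +oo[ ->
    [/\ derivable u a 1, derivable (u^`()%classic) a 1 & u^`()%classic a != 0]
    /\ absolute_risk_aversion u a = (1 - alpha) / (a + c).
  move=> Da; have ac0 := zc0 a Da.
  have pos : 0 < (a + c) `^ (alpha - 1 - 1) by rewrite powR_gt0.
  have powE : (a + c) `^ (alpha - 1) = (a + c) `^ (alpha - 1 - 1) * (a + c).
    by rewrite -[X in _ * X]powRr1 ?ltW // -powRD ?subrK // (gt_eqF ac0) implybT.
  have [] := @absolute_risk_aversionE R u
    (fun z => alpha * (z + c) `^ (alpha - 1)) a
    (alpha * ((alpha - 1) * (a + c) `^ (alpha - 1 - 1))).
  - near=> z; apply: is_derive_shift_powR.
    rewrite -ltrBlDr sub0r; near: z; apply: lt_nbhsr.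
    by rewrite -subr_gt0 opprK.
  - exact: is_deriveZ (is_derive_shift_powR _ ac0).
  - by rewrite mulf_neq0 // gt_eqF // powR_gt0.
  move=> ? ->; split => //; rewrite powE; field.
  by rewrite !gt_eqF.
split=> [a|a b]; first by case/araE.
rewrite !inE => Da Db ab; rewrite (araE a Da).2 (araE b Db).2.
by rewrite ltr_pM2l ?subr_gt0 // ltf_pV2 ?posrE ?zc0 // ltrD2r.
Unshelve. all: by end_near. Qed.

Lemma is_derive_exponential_utility (R : realType) (beta z : R) :
  is_derive z 1 (fun a => 1 - expR (- beta * a)) (beta * expR (- beta * z)).
Proof.
have d := is_deriveB (is_derive_cst (1 : R) z 1) (is_derive_expRM (- beta) z).
by apply: (is_derive_eq d); rewrite sub0r mulNr opprK.
Qed.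

(** The second derivative is [- beta] times the first, so absolute risk aversion is constantly
    [beta]. *)
Lemma exponential_utility_CARA (R : realType) (beta : R) :
  let u := fun a : R => 1 - expR (- beta * a) in
  0 < beta ->
  [/\ strictly_increasing_on setT u, strictly_concave_on setT u
    & CARA_on setT u].
Proof.
move=> u beta0.
have duD z (_ : [set: R] z) := is_derive_exponential_utility beta z.
have itvD : is_interval [set: R] by [].
split.
- by apply: gt0_derive_strictly_increasing itvD duD _ => z _;
    rewrite mulr_gt0 // expR_gt0.
- apply: decreasing_derive_strictly_concave itvD duD _ => a b _ _ ab.
  by rewrite ltr_pM2l // ltr_expR ltr_nM2l // oppr_lt0.
have araE a :
    [/\ derivable u a 1, derivable (u^`()%classic) a 1 & u^`()%classic a != 0]
    /\ absolute_risk_aversion u a = beta.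
  have [] := @absolute_risk_aversionE R u
    (fun z => beta * expR (- beta * z)) a
    (beta * (- beta * expR (- beta * a))).
  - by near=> z; exact: is_derive_exponential_utility.
  - exact: is_deriveZ (is_derive_expRM _ _).
  - by rewrite mulf_neq0 // gt_eqF // expR_gt0.
  move=> ? ->; split => //; field.
  by rewrite !gt_eqF // expR_gt0.
by split=> [a _|a b _ _]; [case: (araE a)|rewrite (araE a).2 (araE b).2].
Unshelve. all: by end_near. Qed.

(** Absolute risk aversion is [2 * l / (1 - 2 * l * a)]; the bound on [e] keeps its denominator,
    which is also the derivative of [u], positive. *)
Lemma quadratic_IARA (R : realType) (l e : R) :
  let u := fun a : R => a - l * a ^+ 2 in
  0 < l -> 2 * l * e <= 1 ->
  [/\ strictly_increasing_on `]- e, e[ u, strictly_concave_on `]- e, e[ u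
    & IARA_on `]- e, e[ u].
Proof.
move=> u l0 le1.
have l20 : 0 < 2 * l by rewrite mulr_gt0.
have du0 z : z \in `]- e, e[ -> 0 < 1 - 2 * l * z.
  rewrite in_itv/= => /andP[_ ze].
  by rewrite subr_gt0 (lt_le_trans _ le1) // ltr_pM2l.
have duD z (_ : z \in `]- e, e[) := is_derive_quadratic l z.
have itvD := @interval_is_interval R `]- e, e[.
split.
- exact: gt0_derive_strictly_increasing itvD duD du0.
- apply: decreasing_derive_strictly_concave itvD duD _ => a b _ _ ab.
  by rewrite ltrD2l ltrN2 ltr_pM2l.
have araE a : a \in `]- e, e[ ->
    [/\ derivable u a 1, derivable (u^`()%classic) a 1 & u^`()%classic a != 0]
    /\ absolute_risk_aversion u a = 2 * l / (1 - 2 * l * a).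
  move=> Da.
  have [] := @absolute_risk_aversionE R u (fun z => 1 - 2 * l * z) a (- (2 * l)).
  - by near=> z; exact: is_derive_quadratic.
  - under eq_fun do rewrite -mulNr.
    exact: is_derive_affine.
  - by rewrite gt_eqF // du0.
  by move=> ? ->; rewrite opprK.
split=> [a|a b]; first by case/araE.
rewrite !inE => Da Db ab; rewrite (araE a Da).2 (araE b Db).2.
by rewrite ltr_pM2l // ltf_pV2 ?posrE ?du0 // ltrD2l ltrN2 ltr_pM2l.
Unshelve. all: by end_near. Qed.

(** The derivative [(1 + g * a) ^- 2] is positive and decreasing. Absolute risk aversion,
    [2 * g / (1 + g * a)], decreases in [a], so no IARA clause appears. *)
Lemma homographic_concave (R : realType) (g : R) :
  let u := fun a : R => a / (1 + g * a) in
  0 < g ->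
  strictly_increasing_on `[0, +oo[ u /\ strictly_concave_on `[0, +oo[ u.
Proof.
move=> u g0.
have gz0 z : z \in `[0, +oo[ -> 0 < 1 + g * z.
  by rewrite in_itv/= andbT => z0; rewrite ltr_pwDl // mulr_ge0 // ltW.
have duD (z : R) : z \in `[0, +oo[ -> is_derive z 1 u ((1 + g * z) ^- 2).
  by move=> Dz; apply: is_derive_homographic; rewrite gt_eqF // gz0.
have itvD := @interval_is_interval R `[0, +oo[.
split.
- apply: gt0_derive_strictly_increasing itvD duD _ => z Dz.
  by rewrite invr_gt0 exprn_gt0 // gz0.
- apply: decreasing_derive_strictly_concave itvD duD _ => a b Da Db ab.
  rewrite ltf_pV2 ?posrE ?exprn_gt0 ?gz0 //.
  by rewrite ltr_pXn2r ?nnegrE ?ltW ?gz0 // ltrD2l ltr_pM2l.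
Qed.

Lemma expRM_convex (R : realType) (d : R) :
  let v := fun a : R => expR (d * a) in
  0 < d -> strictly_increasing_on setT v /\ strictly_convex_on setT v.
Proof.
move=> v d0.
have dvD z (_ : [set: R] z) := is_derive_expRM d z.
have itvD : is_interval [set: R] by [].
split.
- by apply: gt0_derive_strictly_increasing itvD dvD _ => z _;
    rewrite mulr_gt0 // expR_gt0.
- apply: increasing_derive_strictly_convex itvD dvD _ => a b _ _ ab.
  by rewrite ltr_pM2l // ltr_expR ltr_pM2l.
Qed.

(** * Nearly linear members of the six families *)

Theorem mainTheorem3 (R : realType) (Omega : finType) (k : nat)
    (p x : 'I_k -> {ffun Omega -> R})
    (p_nonneg : forall i, nonneg_vec (p i))
    (x_nonneg : forall i, nonneg_vec (x i))
    (p_pos : forall i, positive_vec (p i))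
    (pi : {ffun Omega -> R})
    (pi_prob : probability_measure pi)
    (pi_full : full_support pi)
    (x_rationalized : exists u : R -> R,
      [/\ strictly_concave_on setT u, strictly_increasing_on setT u
        & SEU_rationalizes p x pi u])
    (x_nondiv : forall i, non_diversified (x i)) :
  (* (i) *)
  (forall alpha : R, 0 < alpha -> alpha < 1 ->
     exists c : R, let u1 := fun a : R => (a + c) `^ alpha in
       [/\ 0 < c, SEU_rationalizes p x pi u1,
           strictly_increasing_on `[0, +oo[ u1,
           strictly_concave_on `[0, +oo[ u1
         & DARA_on `[0, +oo[ u1]) /\
  (* (ii) *)
  (exists beta : R, let u2 := fun a : R => 1 - expR (- beta * a) in
     [/\ 0 < beta, SEU_rationalizes p x pi u2,
         strictly_increasing_on setT u2,
         strictly_concave_on setT u2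
       & CARA_on setT u2]) /\
  (* (iii) *)
  (exists lambda : R, let u3 := fun a : R => a - lambda * a ^+ 2 in
     [/\ 0 < lambda, SEU_rationalizes p x pi u3
       & exists e : R,
           [/\ 0 < e, strictly_increasing_on `]- e, e[ u3,
               strictly_concave_on `]- e, e[ u3
             & IARA_on `]- e, e[ u3]]) /\
  (* (iv) *)
  (exists gamma : R, let u4 := fun a : R => a / (1 + gamma * a) in
     [/\ 0 < gamma, SEU_rationalizes p x pi u4,
         strictly_increasing_on `[0, +oo[ u4
       & strictly_concave_on `[0, +oo[ u4]) /\
  (* (v) *)
  (exists s : R, let u := fun a : R => s * a in
     [/\ SEU_rationalizes p x pi u & strictly_increasing_on setT u]) /\
  (* (vi) *)
  (exists v : R -> R,
     [/\ SEU_rationalizes p x pi v, strictly_increasing_on setT v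
       & strictly_convex_on setT v]).
Proof.
have [u [u_conc u_incr u_rat]] := x_rationalized.
have [r [L [r0 r1 L0 ratio budget]]] := uniform_bounds p_pos pi_full
  (fun i w w' => strictly_concave_price_ratio p_pos pi_full x_nondiv
    u_conc u_incr u_rat).
have rationalizes m u' du (m0 : 0 <= m) := @SEU_rationalizes_of_derive_bounds
  R Omega k p x pi p_pos pi_full x_nondiv r L m u' du m0 ratio budget.
have s0 : 0 < 1 - r by rewrite subr_gt0.
have L20 : 0 < 2 * L by rewrite mulr_gt0.
(* With [b * L = 1 - r], the inequality [1 + s <= expR s] gives [r <= expR (- b * z)] on [[0, L]].
   Half of [b] serves the quadratic and homographic utilities, whose slopes at [z] are at least
   [1 - 2 * h * z]. *)
pose b := (1 - r) / L.
have b0 : 0 < b by rewrite divr_gt0.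
have bL : b * L = 1 - r by rewrite divfK ?gt_eqF.
pose h := b / 2.
have h0 : 0 < h by rewrite divr_gt0.
have hL : 2 * h * L = 1 - r by rewrite -bL /h; field.
split=> [alpha alpha0 alpha1|].
  (* This [c] solves [c / (L + c) = r], so the slope at [L] divided by the slope at 0 is [r] to the
     power [1 - alpha], which is at least [r]. *)
  pose c := r * L / (1 - r).
  have c0 : 0 < c by rewrite divr_gt0 // mulr_gt0.
  have Lc0 : 0 < L + c by rewrite addr_gt0.
  have cE : c = r * (L + c).
    have : c * (1 - r) = r * L by rewrite divfK ?gt_eqF.
    lra.
  exists c => u1; have [u1_incr u1_conc u1_DARA] := shift_powR_DARA c0 alpha0 alpha1.
  split=> //.
  apply: (rationalizes (alpha * (L + c) `^ (alpha - 1)) u1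
    (fun z => alpha * (z + c) `^ (alpha - 1))) => [|z|z].
  - by rewrite mulr_ge0 ?powR_ge0 // ltW.
  - rewrite in_itv/= => /andP[z0 _].
    by apply: is_derive_shift_powR; rewrite ltr_wpDl.
  rewrite in_itv/= => /andP[z0 zL].
  have zc0 : 0 < z + c by rewrite ltr_wpDl.
  have decr s t : 0 < s -> s <= t -> t `^ (alpha - 1) <= s `^ (alpha - 1).
    move=> s_gt0 st; have t_gt0 := lt_le_trans s_gt0 st.
    rewrite -opprB !powRN lef_pV2 ?posrE ?powR_gt0 //.
    by apply: ge0_ler_powR; rewrite // ?subr_ge0 ?nnegrE ltW.
  split; first by rewrite ler_pM2l // decr // lerD2r.
  rewrite mulrCA ler_pM2l //.
  (* The slope is largest at [z = 0]. Substituting [c = r * (L + c)] then leaves the factor [r * r]^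
     (alpha - 1) = r [^ alpha], at most 1. *)
  apply: (@le_trans _ _ (r * c `^ (alpha - 1))).
    by rewrite ler_pM2l // decr // lerDr.
  rewrite {1}cE (powRM _ (ltW r0) (ltW Lc0)) mulrA ger_pMl ?powR_gt0 //.
  rewrite -[X in X * _](powRr1 (ltW r0)) -powRD ?(gt_eqF r0) ?implybT //.
  rewrite addrC subrK; suff : r `^ alpha <= 1 `^ alpha by rewrite powR1.
  by apply: ge0_ler_powR; rewrite ?nnegrE ltW.
split.
  exists b => u2; have [u2_incr u2_conc u2_CARA] := exponential_utility_CARA b0.
  split=> //.
  (* Slopes lie between [b * r] and [b]. *)
  apply: (rationalizes (b * r) u2 (fun z => b * expR (- b * z))) => [|z _|z].
  - by rewrite mulr_ge0 // ltW.
  - exact: is_derive_exponential_utility.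
  rewrite in_itv/= => /andP[z0 zL].
  have bz0 : 0 <= b * z by rewrite mulr_ge0 // ltW.
  have bzL : b * z <= b * L by rewrite ler_pM2l.
  split.
    rewrite ler_pM2l // (le_trans _ (expR_ge1Dx _)) //; lra.
  rewrite mulrCA ler_pM2l // -[leRHS]mulr1 ler_pM2l //.
  by rewrite -expR0 ler_expR mulNr oppr_le0.
split.
  exists h => u3; split=> //.
    (* Slopes fall from 1 at 0 to exactly [r] at [L]. *)
    apply: (rationalizes r u3 (fun z => 1 - 2 * h * z)) => [|z _|z].
    - exact: ltW.
    - exact: is_derive_quadratic.
    rewrite in_itv/= => /andP[z0 zL].
    have hz0 : 0 <= 2 * h * z by rewrite mulr_ge0 // mulr_ge0 // ltW.
    have hzL : 2 * h * z <= 2 * h * L by rewrite ler_pM2l // mulr_gt0.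
    split; first by lra.
    by rewrite ger_pMr //; lra.
  exists L; have [|u3_incr u3_conc u3_IARA] := @quadratic_IARA R h L h0.
    by lra.
  by split.
split.
  exists h => u4; have [u4_incr u4_conc] := homographic_concave h0.
  split=> //.
  have hz1 z : 0 <= z -> 1 <= 1 + h * z.
    by move=> z0; rewrite lerDl mulr_ge0 // ltW.
  apply: (rationalizes r u4 (fun z => (1 + h * z) ^- 2)) => [|z|z].
  - exact: ltW.
  - rewrite in_itv/= => /andP[z0 _]; apply: is_derive_homographic.
    by rewrite gt_eqF // (lt_le_trans _ (hz1 z z0)).
  rewrite in_itv/= => /andP[z0 zL].
  have hz0 : 0 <= h * z by rewrite mulr_ge0 // ltW.
  have hzL : h * z <= h * L by rewrite ler_pM2l.
  have sq1 : 1 <= (1 + h * z) ^+ 2 by rewrite exprn_ege1 // hz1.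
  have sq0 : 0 < (1 + h * z) ^+ 2 by rewrite (lt_le_trans _ sq1).
  split; last by rewrite ler_pdivrMr // ler_peMr // ltW.
  rewrite -[leRHS]mul1r ler_pdivlMr //.
  (* With [s = h * z], the product [(1 - 2 * s) * (1 + s) ^+ 2] equals
     [1 - 3 * s ^+ 2 - 2 * s ^+ 3], which is at most 1. *)
  apply: (@le_trans _ _ ((1 - 2 * (h * z)) * (1 + h * z) ^+ 2)).
    by rewrite ler_pM2r //; lra.
  have : 0 <= 3 * (h * z) ^+ 2 + 2 * (h * z) ^+ 3.
    by rewrite addr_ge0 // mulr_ge0 // exprn_ge0.
  lra.
split.
  exists 1 => u5; split=> [|a a' _ _ aa']; last by rewrite /u5 !mul1r.
  apply: (rationalizes 1 u5 (fun=> 1)) => [//|z _|z _]; last first.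
    by split=> //; rewrite mulr1 ltW.
  by have := is_derive_affine 0 1 z; under eq_fun do rewrite add0r.
exists (fun a => expR (b * a)); have [v_incr v_conv] := expRM_convex b0.
split=> //.
(* Convexity puts the smallest slope, [b], at 0; the largest is at most [b / r] because
   [r <= expR (- (b * z))]. *)
apply: (rationalizes b _ (fun z => b * expR (b * z))) => [|z _|z].
- exact: ltW.
- exact: is_derive_expRM.
rewrite in_itv/= => /andP[z0 zL].
have bz0 : 0 <= b * z by rewrite mulr_ge0 // ltW.
have bzL : b * z <= b * L by rewrite ler_pM2l.
split; first by rewrite -[leLHS]mulr1 ler_pM2l // -expR0 ler_expR.
rewrite mulrCA -[leRHS]mulr1 ler_pM2l //.
rewrite -ler_pdivlMr ?expR_gt0 // mul1r -expRN.
by rewrite (le_trans _ (expR_ge1Dx _)) //; lra.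
Qed.
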